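(* Let $\gamma>0$, and let $\mathcal{U}(x)=\{z:\|x-z\|_2\le 1\}$ and $\mathcal{V}(x)=\{z:\|x-z\|_2\le 1+\gamma\}$ for $x\in X=\mathbb{R}^2$. There exists a hypothesis class $\mathcal{H}$ with VC-dimension $1$ such that $\mathcal{H}$ is not tolerantly certifiable with respect to $\mathcal{U}$ and $\mathcal{V}$.
   Context: $Y=\{0,1\}$; a hypothesis class is a set of (Borel) functions $X\to Y$. For a distribution $P$ over $X\times Y$, $P_X$ denotes the marginal of $P$ over $X$, and for $\mathcal{W}\in\{\mathcal{U},\mathcal{V}\}$ the robust loss is $\mathcal{L}^{\mathcal{W}}_P(h)=\Pr_{(x,y)\sim P}[\exists z\in\mathcal{W}(x): h(z)\neq y]$. A label query oracle $\mathcal{O}_h$ for a hypothesis $h$ returns $h(x)$ upon querying $x$, for all $x\in X$. A query-based algorithm is an algorithm $\mathcal{A}:(\bigcup_{i=1}^{\infty}X^i,\mathcal{O}_h)\to\mathbb{R}$, that is, it takes a finite sequence $S$ of (unlabeled) domain points, has access to a label query oracle $\mathcal{O}_h$, and outputs a real number $\mathcal{A}(S,\mathcal{O}_h)$. $\mathcal{U}$ is a restriction of $\mathcal{V}$ if $\mathcal{U}(x)\subseteq\mathcal{V}(x)$ for all $x\in X$. A class $\mathcal{H}$ is tolerantly certifiable with respect to $\mathcal{U}$ and $\mathcal{V}$, where $\mathcal{U}$ is a restriction of $\mathcal{V}$, if there exist a query-based algorithm $\mathcal{A}$ and functions $q,m:(0,1)^2\to\mathbb{N}$ such that for every $\epsilon,\delta\in(0,1)$,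 every distribution $P$ over $X\times Y$, and every $h\in\mathcal{H}$, with probability at least $1-\delta$ over an i.i.d. sample $S\sim P_X^m$ of size $m\ge m(\epsilon,\delta)$ we have $\mathcal{A}(S,\mathcal{O}_h)\in[\mathcal{L}^{\mathcal{U}}_P(h)-\epsilon,\ \mathcal{L}^{\mathcal{V}}_P(h)+\epsilon]$, with a query budget of $q(\epsilon,\delta)$ for $\mathcal{A}$. *)

(* Defs.v *)
From HB Require Import structures.
From mathcomp Require Import all_boot all_order all_algebra.
From mathcomp Require Import all_classical all_reals all_analysis.
From mathcomp Require Import lra.

Set Implicit Arguments.
Unset Strict Implicit.
Unset Printing Implicit Defensive.

Import Order.TTheory GRing.Theory Num.Theory.
Import numFieldNormedType.Exports.

Local Open Scope classical_set_scope.
Local Open Scope ring_scope.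

Section iid_samples.
Context d (X : measurableType d) (R : realType).
Local Open Scope ereal_scope.

Definition tuple_cons n (p : X * n.-tuple X) : n.+1.-tuple X :=
  [tuple of p.1 :: p.2].

Lemma measurable_tuple_cons n : measurable_fun setT (@tuple_cons n).
Proof. exact: measurable_cons. Qed.

HB.instance Definition _ n :=
  isMeasurableFun.Build _ _ _ _ (@tuple_cons n) (@measurable_tuple_cons n).

(* The n-fold product measure Q^n. *)
Fixpoint iid (Q : probability X R) n : probability (n.-tuple X) R :=
  if n is k.+1 then distribution (Q \x iid Q k) (@tuple_cons k)
  else dirac [tuple].

Lemma iidE (Q : probability X R) n (A : 'I_n -> set X) :
  (forall i, measurable (A i)) ->
  iid Q n [set t | forall i, A i (tnth t i)] = \prod_(i < n) Q (A i).
Proof.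
elim: n A => [|n IH] A mA /=.
  by rewrite big_ord0 diracE mem_set//= => -[].
rewrite big_ord_recl /distribution /pushforward /=.
have -> : @tuple_cons n @^-1` [set t | forall i, A i (tnth t i)] =
    A ord0 `*` [set t | forall i, A (lift ord0 i) (tnth t i)].
  apply/seteqP; split => -[x t] /= H.
    split; first exact: (H ord0).
    by move=> i; have := H (lift ord0 i); rewrite tnthS.
  case: H => Hx Ht i; case: (unliftP ord0 i) => [j|] ->; rewrite ?tnthS//=.
rewrite product_measure1E//; last first.
  rewrite (_ : mkset _ = \big[setI/setT]_(i < n)
      ((fun t : n.-tuple X => tnth t i) @^-1` A (lift ord0 i))).
    apply: bigsetI_measurable => i _; rewrite -[X in measurable X]setTI.
    exact: measurable_tnth.
  rewrite -bigcap_seq; apply/seteqP; split => [t H i _|t H i] /=.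
    exact: H.
  by apply: (H i); rewrite /= mem_index_enum.
by congr (_ * _); apply: (IH (fun i => A (lift ord0 i))) => i; exact: mA.
Qed.

End iid_samples.

Section tolerant_certification.
Context d (X : measurableType d) (R : realType).
Local Open Scope ereal_scope.

Definition shattered (H : set {mfun X >-> bool}) (C : set X) :=
  forall B, B `<=` C -> exists2 h, H h & C `&` [set x | h x] = B.

Definition has_VC_dimension (H : set {mfun X >-> bool}) (n : nat) :=
  (exists2 C, (C #= `I_n)%card & shattered H C) /\
  (forall C k, (C #= `I_k)%card -> shattered H C -> (k <= n)%N).

(* A perturbation type maps a point to the set of its perturbations. *)
Definition is_restriction (U V : X -> set X) := forall x, U x `<=` V x.

HB.instance Definition _ :=
  isMeasurableFun.Build _ _ _ _ (@fst X bool) measurable_fst.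

Definition marginal (P : probability (X * bool)%type R) : probability X R :=
  distribution P (@fst X bool).

(* The set whose probability is taken need not be Borel (for closed balls it is
   analytic, hence in the completion of P), so the probability is given by the
   outer measure: it agrees with P on measurable sets and with the completion
   of P on completion-measurable ones. *)
Definition robust_loss (W : X -> set X) (P : probability (X * bool)%type R)
    (h : X -> bool) : \bar R :=
  (P^*)%mu [set xy | exists2 z, W xy.1 z & h z != xy.2].

(* An adaptive deterministic computation with access to a label oracle: it stops
   with a real number, or queries a point and continues depending on the
   label. *)
Inductive query_tree :=
  | Output of R
  | Query of X & (bool -> query_tree).

Fixpoint run (h : X -> bool) (t : query_tree) : R :=
  match t with
  | Output r => r
  | Query x k => run h (k (h x))
  end.

Fixpoint num_queries (h : X -> bool) (t : query_tree) : nat :=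
  match t with
  | Output _ => 0%N
  | Query x k => (num_queries h (k (h x))).+1
  end.

Definition query_algorithm := forall n, n.+1.-tuple X -> query_tree.

(* Algorithms are arbitrary functions of the sample, so E need not be
   measurable. *)
Definition with_probability_at_least d' (T : measurableType d')
    (Q : probability T R) (p : R) (E : set T) :=
  exists A, [/\ measurable A, A `<=` E & p%:E <= Q A].

Definition tolerantly_certifiable (U V : X -> set X) (_ : is_restriction U V)
    (H : set {mfun X >-> bool}) :=
  exists (A : query_algorithm) (q m : R -> R -> nat),
    forall eps delta : R, (0 < eps < 1)%R -> (0 < delta < 1)%R ->
    forall (P : probability (X * bool)%type R) (h : {mfun X >-> bool}), H h ->
    forall n, (m eps delta <= n.+1)%N ->
      with_probability_at_least (iid (marginal P) n.+1) (1 - delta)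
        [set S | robust_loss U P h - eps%:E <= (run h (A n S))%:E
                 <= robust_loss V P h + eps%:E] /\
      forall S, (num_queries h (A n S) <= q eps delta)%N.

End tolerant_certification.

Section plane.
Context (R : realType).

Definition l2norm (x : R * R) : R := Num.sqrt (x.1 ^+ 2 + x.2 ^+ 2).

Definition l2ball (r : R) (x : R * R) : set (R * R) :=
  [set z | l2norm (x - z) <= r].

Lemma l2ball_restriction (gamma : R) :
  0 < gamma -> is_restriction (l2ball 1) (l2ball (1 + gamma)).
Proof. by move=> g0 x z; rewrite /l2ball /=; lra. Qed.

End plane.

(* Main.v *)
Require Import Defs.
From HB Require Import structures.
From mathcomp Require Import all_boot all_order all_algebra.
From mathcomp Require Import all_classical all_reals all_analysis.
From mathcomp Require Import lra.

Set Implicit Arguments.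
Unset Strict Implicit.
Unset Printing Implicit Defensive.

Import Order.TTheory GRing.Theory Num.Theory.
Local Open Scope classical_set_scope.
Local Open Scope ring_scope.

(** Take for [H] the indicators of sets with at most one point, and for [P] the
  point mass at [(x, 0)].  The sample carries no information, and on the zero
  hypothesis the algorithm makes finitely many queries, so some [z] in [U(x)]
  is not queried.  The algorithm cannot tell the indicator of [z] from zero,
  although the robust losses are 1 and 0. *)

Lemma measurable_set1_pair d1 d2 (X : measurableType d1) (Y : measurableType d2)
    (x : X) (y : Y) :
  measurable [set x] -> measurable [set y] -> measurable [set (x, y)].
Proof.
move=> mx my; rewrite (_ : [set (x, y)] = [set x] `*` [set y]).
  exact: measurableX.
by apply/seteqP; split => [_ ->|[_ _] [/= -> ->]].
Qed.

Section singletons.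
Context d (X : measurableType d).
Hypothesis measurable_singleton : forall x : X, measurable [set x].

Definition at_most_one_positive : set {mfun X >-> bool} :=
  [set h : {mfun X >-> bool} | is_subset1 [set x | h x]].

Lemma singleton_mfun (x : X) :
  exists h : {mfun X >-> bool}, [set y | h y] = [set x].
Proof.
pose f (y : X) := `[< y = x >].
have fx : [set y | f y] = [set x].
  by apply/seteqP; split => y /= /asboolP.
have mf : measurable_fun setT f.
  by apply: (measurable_fun_bool true); rewrite setTI -[_ @^-1` _]/[set y | f y] fx.
pose F : {mfun X >-> bool} := HB.pack f (isMeasurableFun.Build _ _ _ _ f mf).
by exists F.
Qed.

Lemma has_VC_dimension_at_most_one_positive (x : X) :
  has_VC_dimension at_most_one_positive 1.
Proof.
split.
  exists [set x]; first exact: card_set1.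
  move=> B /subset_set1[->|->].
    by exists (cst false) => //; apply/seteqP; split => y // [].
  have [h hx] := singleton_mfun x; exists h; last by rewrite hx setIid.
  by rewrite /at_most_one_positive /= hx => y z /= -> ->.
(* For the upper bound it is enough to realize the subset [B = C]: this puts [C] inside the positive
   set of a single [h], which has at most one point. *)
move=> C k Ck /(_ C (@subset_refl _ C))[h h1] /setIidPl Ch.
rewrite -card_le_II -(card_le_eql Ck).
have [->|/set0P[y Cy]] := eqVneq C set0; first exact: card_ge0.
rewrite -(card_le_eqr (@card_set1 _ y)); apply: subset_card_le => z Cz.
by apply: h1; exact: Ch.
Qed.

End singletons.

Section query_trees.
Context d (X : measurableType d) (R : realType).

(** [F] collects the points queried along the branch that [h] follows. A function with the same
    labels there follows the same branch to the same output. *)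
Lemma finite_queries (h : X -> bool) (t : query_tree X R) :
  exists2 F, finite_set F &
    forall h' : X -> bool, {in F, h' =1 h} -> run h' t = run h t.
Proof.
elim: t => [r|x k IH] /=; first by exists set0.
have [F finF runF] := IH (h x).
exists (x |` F); first by rewrite finite_setU; split.
move=> h' hh'; rewrite hh' ?inE//=; last by left.
by apply: runF => y; rewrite inE => Fy; apply: hh'; rewrite inE; right.
Qed.

End query_trees.

Section point_mass.
Context d (X : measurableType d) (R : realType).
Hypothesis measurable_singleton : forall x : X, measurable [set x].
Implicit Types (Q : probability X R) (P : probability (X * bool)%type R).
Local Open Scope ereal_scope.

(** The constant sample is almost sure, so every event of positive probability contains it. This
    turns the probabilistic guarantee into a statement about one fixed sample. *)
Lemma iid_point_mass Q x n (p : R) (E : set (n.-tuple X)) :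
  Q [set x] = 1 -> (0 < p)%R ->
  with_probability_at_least (iid Q n) p E -> E [tuple of nseq n x].
Proof.
move=> Qx p0 [A [mA AE pA]]; apply: AE; apply: contrapT => nA.
pose B : set (n.-tuple X) := [set t | forall i, [set x] (tnth t i)].
have QB : iid Q n B = 1.
  by rewrite (@iidE _ _ _ Q n (fun=> [set x]))// big1.
have mB : measurable B.
  rewrite (_ : B = \big[setI/setT]_(i < n)
      ((fun t : n.-tuple X => tnth t i) @^-1` [set x])).
    apply: bigsetI_measurable => i _; rewrite -[X in measurable X]setTI.
    exact: measurable_tnth.
  rewrite -bigcap_seq; apply/seteqP; split => t H i.
    by move=> _; exact: H.
  by apply: (H i); rewrite /= mem_index_enum.
suff : iid Q n A <= 0 by move=> /(le_trans pA); rewrite lee_fin leNgt p0.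
have -> : 0 = iid Q n (~` B) by rewrite probability_setC// QB subee.
apply: le_measure; rewrite ?inE//; first exact: measurableC.
move=> t At Bt; apply: nA; rewrite (_ : [tuple of _] = t)//.
by apply: eq_from_tnth => i; rewrite tnth_nseq (Bt i).
Qed.

(** The error event misses the atom [(x, false)], so it lies in a measurable null set. Monotonicity
    of the outer measure then suffices, whether or not the event is measurable. *)
Lemma robust_loss_dirac_eq0 (W : X -> set X) (h : X -> bool) x :
  W x `<=` [set z | ~~ h z] ->
  robust_loss W (@dirac _ (X * bool)%type (x, false) R) h = 0.
Proof.
move=> Wh; apply/eqP; rewrite eq_le mu_ext_ge0// andbT.
have m1 : measurable [set (x, false)].
  exact: measurable_set1_pair.
have <- : (@dirac _ _ (x, false) R)^*%mu (~` [set (x, false)]) = 0.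
  rewrite measurable_mu_extE; last exact: measurableC.
  by rewrite /= diracE memNset//= => /(_ erefl).
apply: le_mu_ext => -[y b] /= [z Wz hz] [yx b0].
by move: hz Wz; rewrite yx b0 => hz /Wh /=; case: (h z) hz.
Qed.

(** Dually, [z] witnesses that the error event contains the atom. *)
Lemma robust_loss_dirac_ge1 (W : X -> set X) (h : X -> bool) x z :
  W x z -> h z ->
  1 <= robust_loss W (@dirac _ (X * bool)%type (x, false) R) h.
Proof.
move=> Wz hz.
have m1 : measurable [set (x, false)].
  exact: measurable_set1_pair.
have <- : (@dirac _ _ (x, false) R)^*%mu [set (x, false)] = 1.
  by rewrite measurable_mu_extE//= diracE mem_set.
by apply: le_mu_ext => _ -> /=; exists z => //; rewrite hz.
Qed.

Lemma not_tolerantly_certifiable_at_most_one_positive (U V : X -> set X)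
    (UV : is_restriction U V) x :
  infinite_set (U x) ->
  ~ tolerantly_certifiable R UV (@at_most_one_positive _ X).
Proof.
move=> Uinf [A [q [m cert]]].
pose P : probability (X * bool)%type R := dirac (x, false).
(* With accuracy 1/3 the output must be at most 1/3 on the zero hypothesis and at least 2/3 on the
   indicator of [z], so the two cannot coincide. *)
have e01 : (0 < (3^-1 : R) < 1)%R by lra.
pose n := m 3^-1%R 3^-1%R.
have Px : marginal P [set x] = 1.
  by rewrite /marginal /distribution /pushforward /= diracE mem_set.
pose S := [tuple of nseq n.+1 x].
have out (h : {mfun X >-> bool}) : at_most_one_positive h ->
    robust_loss U P h - 3^-1%:E <= (run h (A n S))%:E
      <= robust_loss V P h + 3^-1%:E.
  move=> Hh; have [+ _] := cert _ _ e01 e01 P h Hh n (leqnSn n).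
  by move=> /(iid_point_mass Px); apply; lra.
have [F finF runF] := finite_queries (cst false) (A n S).
have [z [Uz nFz]] : exists z, U x z /\ ~ F z.
  apply: contrapT => UF; apply: Uinf; apply: sub_finite_set finF => z Uz.
  by apply: contrapT => nFz; apply: UF; exists z.
have [h hz] := singleton_mfun measurable_singleton z.
have h1 : at_most_one_positive h.
  by rewrite /at_most_one_positive /= hz => y w /= -> ->.
have eqrun : run h (A n S) = run (cst false) (A n S).
  (* The two hypotheses differ only at [z], which is outside [F]. *)
  apply: runF => y; rewrite inE => Fy; apply/negbTE/negP => hy.
  have : [set y | h y] y by [].
  by rewrite hz => yz; apply: nFz; rewrite -yz.
have hzz : h z by have : [set z] z by []; rewrite -hz.
have /andP[+ _] := out h h1.
have /andP[_ +] : _ := out (cst false) (fun _ _ h0 => False_ind _ (notF h0)).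
rewrite robust_loss_dirac_eq0// add0e lee_fin eqrun => r_le le_r.
have := le_trans (leeB (robust_loss_dirac_ge1 Uz hzz) (lexx _)) le_r.
by rewrite -EFinB lee_fin; lra.
Qed.

End point_mass.

Lemma infinite_l2ball (R : realType) (r : R) (x : R * R) :
  0 < r -> infinite_set (l2ball r x).
Proof.
(* These points are pairwise distinct, and the distance of [f n] from the centre is [r / n.+1],
   hence at most [r]. *)
move=> r0; pose f (n : nat) := (x.1 - r / n.+1%:R, x.2).
have f_inj : injective f.
  by move=> m n [] /addrI /oppr_inj /(mulfI (lt0r_neq0 r0)) /invr_inj /eqP;
    rewrite eqr_nat => /eqP[].
apply: (@sub_infinite_set _ (range f)) => [_ [n _ <-]|].
  rewrite /l2ball /= /l2norm /= subrr expr0n addr0 opprB addrC subrK.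
  rewrite sqrtr_sqr ger0_norm; last by rewrite divr_ge0// ltW.
  by rewrite ler_pdivrMr// ler_peMr ?ler1n// ltW.
by rewrite infiniteP (card_le_eqr (inj_card_eq (in2W f_inj))).
Qed.

Theorem mainTheorem9 (R : realType) (gamma : R) (gamma_gt0 : 0 < gamma) :
  exists H : set {mfun (R * R)%type >-> bool},
    has_VC_dimension H 1 /\
    ~ @tolerantly_certifiable _ (R * R)%type R (l2ball 1) (l2ball (1 + gamma))
        (l2ball_restriction gamma_gt0) H.
Proof.
have m1 (z : R * R) : measurable [set z].
  by case: z => a b; exact: measurable_set1_pair.
exists (@at_most_one_positive _ (R * R)%type); split.
  exact: (has_VC_dimension_at_most_one_positive m1 0).
apply: (not_tolerantly_certifiable_at_most_one_positive m1 (x := 0)).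
exact: infinite_l2ball.
Qed.
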